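(* For all integers $n\ge 0$ and $t\ge 0$, the following hold. (i) $B_{35}^{(35t+4)}(35n+\alpha)\equiv 0\pmod{35}$ for every $\alpha\in\{13,34\}$. (ii) $B_{35}^{(35t+6)}(35n+\alpha)\equiv 0\pmod{35}$ for every $\alpha\in\{4,24,34\}$. (iii) $B_{35}^{(35t+11)}(35n+34)\equiv 0\pmod{35}$. (iv) $B_{35}^{(35t+27)}(35n+\alpha)\equiv 0\pmod{35}$ for every $\alpha\in\{3,4,13,17,18,24,27,32,34\}$. (v) $B_{35}^{(35t+32)}(35n+\alpha)\equiv 0\pmod{35}$ for every $\alpha\in\{13,27,34\}$. (vi) $B_{35}^{(35t+34)}(35n+\alpha)\equiv 0\pmod{35}$ for every $\alpha\in\{3,4,13,18,24,34\}$.
   Context: For positive integers $\ell,r$ and an integer $n\ge 0$, $B_\ell^{(r)}(n)$ denotes the number of $\ell$-regular $r$-multipartitions of $n$, i.e. ordered $r$-tuples $(\lambda^{(1)},\dots,\lambda^{(r)})$ of (possibly empty) integer partitions, each having no part divisible by $\ell$, whose sizes sum to $n$; $B_\ell^{(r)}(0)=1$. Equivalently, as formal power series, $$\sum_{n=0}^\infty B_\ell^{(r)}(n)q^n=\frac{E_\ell^r}{E_1^r},\qquad E_k:=\prod_{m=1}^\infty(1-q^{km}).$$ *)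

(* Defs.v *)
From mathcomp Require Import all_boot.

Set Implicit Arguments.
Unset Strict Implicit.
Unset Printing Implicit Defensive.

Definition is_partition (s : seq nat) : bool :=
  sorted geq s && all (fun k => 0 < k) s.

Definition is_regular (l : nat) (s : seq nat) : bool :=
  all (fun k => ~~ (l %| k)) s.

(* In a multipartition of n every component has at most n parts, each at most
   n, so the components can be taken in the finite type of sequences of length
   at most n over {0, ..., n}. *)
Definition parts (n : nat) (s : {bseq n of 'I_n.+1}) : seq nat :=
  [seq val k | k <- s].

Definition regular_multipartitions (l r n : nat) :
    {set r.-tuple {bseq n of 'I_n.+1}} :=
  [set t : r.-tuple {bseq n of 'I_n.+1} |
     all (fun s => is_partition (parts s) && is_regular l (parts s)) t
     && (\sum_(s <- t) sumn (parts s) == n)].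

Definition B (l r n : nat) : nat := #|regular_multipartitions l r n|.

(* Main.v *)
(* Let p be 5 or 7, let G be the generating function of 35-regular partitions
   and choose e in {1, 3, 4} with r + e = p k. From G E_1 = E_35 we get
   G^r (E_1^p)^k = E_35^r E_1^e, and modulo p both E_1^p and E_35 are power
   series in q^p. Hence the coefficients of G^r vanish modulo p on every residue
   class modulo p on which those of E_1^e vanish. The exponents j of E_1 satisfy
   24 j + 1 = x^2 by Euler's pentagonal number theorem, and those of E_1^3
   satisfy 8 j + 1 = y^2 with coefficient +-y by Jacobi's identity; both
   identities are obtained from finite versions by truncation. *)

Require Import Defs.
From mathcomp Require Import all_boot all_algebra.
From mathcomp Require Import zify ring.

Set Implicit Arguments.
Unset Strict Implicit.
Unset Printing Implicit Defensive.

Import GRing.Theory.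
Local Open Scope ring_scope.

(** * Finite forms of Euler's and Jacobi's identities *)

Definition qpoch (A : comNzRingType) (q : A) (m n : nat) : A :=
  \prod_(m <= i < n) (1 - q ^+ i.+1).

Lemma qpoch_recr (A : comNzRingType) (q : A) (m n : nat) : (m <= n)%N ->
  qpoch q m n.+1 = qpoch q m n * (1 - q ^+ n.+1).
Proof. by move=> le_mn; rewrite /qpoch big_nat_recr. Qed.

Lemma qpoch_recl (A : comNzRingType) (q : A) (m n : nat) : (m < n)%N ->
  qpoch q m n = (1 - q ^+ m.+1) * qpoch q m.+1 n.
Proof. by move=> lt_mn; rewrite /qpoch big_ltn. Qed.

Lemma qpochnn (A : comNzRingType) (q : A) (n : nat) : qpoch q n n = 1.
Proof. by rewrite /qpoch big_geq. Qed.

Lemma bin2S (n : nat) : 'C(n.+1, 2) = ('C(n, 2) + n)%N.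
Proof. by rewrite binS bin1. Qed.

(* Shanks's finite form of Euler's pentagonal number theorem. *)
Lemma shanks (A : comNzRingType) (q : A) (n : nat) :
  \sum_(s < n.+1) (-1) ^+ s * q ^+ (s * n + 'C(s.+1, 2)) * qpoch q s n =
  1 + \sum_(j < n) (-1) ^+ j.+1 *
        (q ^+ (j.+1 * j.+1 + 'C(j.+1, 2)) + q ^+ (j.+1 * j.+1 + 'C(j.+2, 2))).
Proof.
elim: n => [|n IHn].
  by rewrite big_ord_recl !big_ord0 /= qpochnn muln0 !addr0 !mulr1.
rewrite [in RHS]big_ord_recr /= addrA -IHn big_ord_recr /= qpochnn.
(* Passing from n to n+1 changes each partial sum by one boundary term. At m = n that term and the
   new summand s = n+1 are the two new terms on the right. *)
have step m : (m <= n)%N ->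
    \sum_(s < m.+1) (-1) ^+ s * q ^+ (s * n.+1 + 'C(s.+1, 2)) * qpoch q s n.+1 =
    \sum_(s < m.+1) (-1) ^+ s * q ^+ (s * n + 'C(s.+1, 2)) * qpoch q s n
    - (-1) ^+ m * q ^+ (m.+1 * n.+1 + 'C(m.+1, 2)) * qpoch q m n.
  elim: m => [|m IHm] le_mn.
    rewrite !big_ord_recl !big_ord0 /= qpoch_recr // !mul0n !mul1n !addn0 /=.
    ring.
  rewrite big_ord_recr /= IHm ?(ltnW le_mn) // [in RHS]big_ord_recr /=.
  rewrite qpoch_recr // (qpoch_recl q le_mn) !(bin2S m.+1) !(mulSn, mulnS).
  move: 'C(m.+1, 2) (m * n)%N => T u.
  by rewrite !(addSn, addnS, exprS, exprD); ring.
rewrite step // qpochnn (bin2S n.+1) !(mulSn, mulnS).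
move: 'C(n.+1, 2) (n * n)%N (\sum_(s < _) _) => T u S.
by rewrite !(addSn, addnS, exprS, exprD); ring.
Qed.

(* The Gaussian binomial [a - 1 + b choose b], and 0 for a = 0; the shift of a
   lets the three-term recurrence hold without a boundary case. *)
Fixpoint qbin (A : comNzRingType) (q : A) (a b : nat) : A :=
  if a is a'.+1 then
    (fix aux b := if b is b'.+1 then qbin q a' b + q ^+ a' * aux b' else 1) b
  else 0.

Arguments qbin : simpl never.

Lemma qbin0 (A : comNzRingType) (q : A) (b : nat) : qbin q 0 b = 0.
Proof. by []. Qed.

Lemma qbinSS (A : comNzRingType) (q : A) (a b : nat) :
  qbin q a.+1 b.+1 = qbin q a b.+1 + q ^+ a * qbin q a.+1 b.
Proof. by []. Qed.

Lemma qbinS0 (A : comNzRingType) (q : A) (a : nat) : qbin q a.+1 0 = 1.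
Proof. by []. Qed.

Lemma qbin1 (A : comNzRingType) (q : A) (b : nat) : qbin q 1 b = 1.
Proof. by elim: b => // b IHb; rewrite qbinSS IHb /= add0r mul1r. Qed.

(** The product formula for Gaussian binomials, with denominators cleared so that it holds in any
    commutative ring. *)
Lemma qbin_qpoch (A : comNzRingType) (q : A) (a b : nat) :
  qbin q a.+1 b * qpoch q 0 a * qpoch q 0 b = qpoch q 0 (a + b).
Proof.
elim: a b => [|a IHa] b.
  by rewrite qpochnn mulr1 add0n qbin1 mul1r.
elim: b => [|b IHb]; first by rewrite qbinS0 qpochnn mulr1 mul1r addn0.
rewrite qbinSS; move: (IHa b.+1) IHb; rewrite !addSn !addnS !qpoch_recr //.
(* This splits 1 - q^(a+b+2) as (1 - q^(a+1)) + q^(a+1) (1 - q^(b+1)), one summand for each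
   induction hypothesis. *)
move=> Ea Eb; transitivity (
    (qbin q a.+1 b.+1 * qpoch q 0 a * (qpoch q 0 b * (1 - q ^+ b.+1)))
      * (1 - q ^+ a.+1)
    + q ^+ a.+1 * (1 - q ^+ b.+1)
      * (qbin q a.+2 b * (qpoch q 0 a * (1 - q ^+ a.+1)) * qpoch q 0 b)).
  by ring.
by rewrite Ea Eb !exprS !exprD; ring.
Qed.

(** Relates neighbours in row a + b of the q-Pascal triangle; it converts the defining q-Pascal rule
    into the dual rule [qbinSSr]. *)
Lemma qbin_ratio (A : comNzRingType) (q : A) (a b : nat) :
  (1 - q ^+ a) * qbin q a.+1 b = (1 - q ^+ b.+1) * qbin q a b.+1.
Proof.
elim: a b => [|a IHa] b; first by rewrite subrr mul0r mulr0.
elim: b => [|b IHb].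
  by rewrite (qbinSS q a 0) mulrDr -IHa !qbinS0 !exprS; ring.
rewrite (qbinSS q a.+1 b) mulrDr mulrCA IHb.
by rewrite [in RHS](qbinSS q a b.+1) [RHS]mulrDr -IHa !exprS; ring.
Qed.

Lemma qbinSSr (A : comNzRingType) (q : A) (a b : nat) :
  qbin q a.+1 b.+1 = q ^+ b.+1 * qbin q a b.+1 + qbin q a.+1 b.
Proof.
have /eqP := qbin_ratio q a b; rewrite !mulrBl !mul1r eq_sym subr_eq => /eqP E.
by rewrite qbinSS {1}E; ring.
Qed.

Lemma qbin_sym (A : comNzRingType) (q : A) (a b : nat) :
  qbin q a.+1 b = qbin q b.+1 a.
Proof.
elim: a b => [|a IHa] b; first by rewrite qbin1 qbinS0.
elim: b => [|b IHb]; first by rewrite qbin1 qbinS0.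
by rewrite qbinSS [in RHS]qbinSSr IHa IHb addrC.
Qed.

(** One q-Pascal rule followed by the other descends two rows, as needed for [jcoef], whose
    binomials lie in row 2n+1. *)
Lemma qbin_three_term (A : comNzRingType) (q : A) (a b : nat) :
  qbin q a.+2 b.+2 = q ^+ b.+2 * qbin q a b.+2
    + (1 + q ^+ (a + b).+2) * qbin q a.+1 b.+1 + q ^+ a.+1 * qbin q a.+2 b.
Proof.
rewrite qbinSS (qbinSSr q a b.+1) (qbinSSr q a.+1 b) !exprS !exprD; ring.
Qed.

(* The coefficient of z^k in prod_(1 <= i <= n) (1 - z q^i) * prod_(0 <= i <= n)
   (1 - q^i / z), for 0 <= k; it is antisymmetric under k -> -1 - k. *)
Definition jcoef (A : comNzRingType) (q : A) (n k : nat) : A :=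
  (-1) ^+ k * q ^+ 'C(k.+1, 2) * qbin q (n.+1 - k) (n + k).+1.

(** The recurrence [jcoefSS] at index 0, with the coefficient at -1 replaced by minus the one at 0
    by antisymmetry. *)
Lemma jcoefS0 (A : comNzRingType) (q : A) (n : nat) :
  jcoef q n.+1 0 = (1 + q ^+ n.+1 * q ^+ n.+1) * jcoef q n 0
    - q ^+ n.+1 * (jcoef q n 1 - jcoef q n 0).
Proof.
rewrite /jcoef !subn0 !addn0 qbin_three_term subSS subn0 addn1 /=.
rewrite (_ : 'C(1, 2) = 0)%N // (_ : 'C(2, 2) = 1)%N // (qbin_sym q n.+1 n).
by rewrite !exprS exprD; ring.
Qed.

(** Going from n to n+1 multiplies the product by (1 - z q^(n+1)) (1 - q^(n+1) / z) = 1 + q^(2n+2) -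
    q^(n+1) (z + 1/z). *)
Lemma jcoefSS (A : comNzRingType) (q : A) (n k : nat) :
  jcoef q n.+1 k.+1 = (1 + q ^+ n.+1 * q ^+ n.+1) * jcoef q n k.+1
    - q ^+ n.+1 * (jcoef q n k + jcoef q n k.+2).
Proof.
rewrite /jcoef.
have [lt_kn | le_nk] := ltnP k n.
  have [j ->] : exists j, n = (k + j).+1 by exists (n - k.+1)%N; lia.
  have -> : ((k + j).+3 - k.+1 = j.+2)%N by lia.
  have -> : ((k + j).+2 - k.+1 = j.+1)%N by lia.
  have -> : ((k + j).+2 - k = j.+2)%N by lia.
  have -> : ((k + j).+2 - k.+2 = j)%N by lia.
  have -> : ((k + j).+2 + k.+1 = ((k + j).+1 + k).+2)%N by lia.
  have -> : ((k + j).+1 + k.+1 = ((k + j).+1 + k).+1)%N by lia.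
  have -> : ((k + j).+1 + k.+2 = ((k + j).+1 + k).+2)%N by lia.
  rewrite qbin_three_term (bin2S k.+2) (bin2S k.+1).
  rewrite !(addSn, addnS, exprS, exprD); ring.
have [-> | lt_nk] := eqVneq k n.
  have -> : (n.+1 - n.+2 = 0)%N by lia.
  rewrite !subSnn subnn !qbin1 !qbin0 (bin2S n.+1).
  move: 'C(n.+1, 2) 'C(n.+3, 2) => T U.
  rewrite exprD !exprS; ring.
have -> : (n.+2 - k.+1 = 0)%N by lia.
have -> : (n.+1 - k.+1 = 0)%N by lia.
have -> : (n.+1 - k = 0)%N by lia.
have -> : (n.+1 - k.+2 = 0)%N by lia.
by rewrite !qbin0; ring.
Qed.

(** This is the derivative of the product at z = 1: the factor 1 - 1/z vanishes there and the others
    give the square. Pairing k with -1 - k produces the weight 2k+1. *)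
Lemma finite_jacobi (A : comNzRingType) (q : A) (n : nat) :
  \sum_(k < n.+1) k.*2.+1%:R * jcoef q n k = qpoch q 0 n ^+ 2.
Proof.
elim: n => [|n IHn].
  by rewrite big_ord_recl big_ord0 /jcoef qpochnn subn0 qbin1 bin_small //
    !expr0 addr0 !mulr1 expr1n.
(* The weights are linear in k, so the neighbours in the recurrence contribute twice the middle
   weight and 1 + q^(2n+2) - 2 q^(n+1) is a square. Only boundary terms remain, and they vanish once
   m > n. *)
have step m : \sum_(k < m.+1) k.*2.+1%:R * jcoef q n.+1 k =
    (1 - q ^+ n.+1) ^+ 2 * (\sum_(k < m.+1) k.*2.+1%:R * jcoef q n k)
    + q ^+ n.+1 * (m.*2.+3%:R * jcoef q n m - m.*2.+1%:R * jcoef q n m.+1).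
  elim: m => [|m IHm].
    by rewrite !big_ord_recl !big_ord0 double0 jcoefS0; ring.
  rewrite big_ord_recr /= IHm jcoefSS [in RHS]big_ord_recr /=.
  by rewrite -!muln2; ring.
rewrite step big_ord_recr /= IHn qpoch_recr //.
have Z k : (n < k)%N -> jcoef q n k = 0.
  by move=> lt_nk; rewrite /jcoef (_ : n.+1 - k = 0)%N ?qbin0 ?mulr0 //; lia.
rewrite !Z //; ring.
Qed.

(** * Truncated power series *)

Definition eq_upto (R : nzRingType) (N : nat) (p q : {poly R}) : Prop :=
  forall i, (i <= N)%N -> p`_i = q`_i.

Lemma eq_upto_sym (R : nzRingType) (N : nat) (p q : {poly R}) :
  eq_upto N p q -> eq_upto N q p.
Proof. by move=> E i le_iN; rewrite E. Qed.

Lemma eq_upto_trans (R : nzRingType) (N : nat) (p q r : {poly R}) :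
  eq_upto N p q -> eq_upto N q r -> eq_upto N p r.
Proof. by move=> E F i le_iN; rewrite E // F. Qed.

Lemma eq_upto_leq (R : nzRingType) (M N : nat) (p q : {poly R}) :
  (M <= N)%N -> eq_upto N p q -> eq_upto M p q.
Proof. by move=> le_MN E i le_iM; apply: E; apply: leq_trans le_MN. Qed.

Lemma eq_uptoM (R : nzRingType) (N : nat) (p q p' q' : {poly R}) :
  eq_upto N p q -> eq_upto N p' q' -> eq_upto N (p * p') (q * q').
Proof.
move=> E E' i le_iN; rewrite !coefM; apply: eq_bigr => j _.
by rewrite E ?E' //; move: (ltn_ord j); lia.
Qed.

Lemma eq_uptoX (R : nzRingType) (N k : nat) (p q : {poly R}) :
  eq_upto N p q -> eq_upto N (p ^+ k) (q ^+ k).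
Proof. by move=> E; elim: k => // k IHk; rewrite !exprS; apply: eq_uptoM. Qed.

Lemma eq_upto_sum (R : nzRingType) (N : nat) (I : Type) (s : seq I)
    (P : pred I) (F G : I -> {poly R}) :
  (forall i, P i -> eq_upto N (F i) (G i)) ->
  eq_upto N (\sum_(i <- s | P i) F i) (\sum_(i <- s | P i) G i).
Proof.
move=> E i le_iN; rewrite !coef_sum; apply: eq_bigr => j Pj; exact: E.
Qed.

Lemma eq_upto_Xn (R : nzRingType) (N k : nat) (p q : {poly R}) :
  eq_upto (N - k) p q -> eq_upto N ('X^k * p) ('X^k * q).
Proof.
move=> E i le_iN; rewrite !coefXnM; case: ltnP => // le_ki.
by apply: E; lia.
Qed.

Lemma eq_upto_cancel (R : nzRingType) (N : nat) (u p q : {poly R}) :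
  u`_0 = 1 -> eq_upto N (u * p) (u * q) -> eq_upto N p q.
Proof.
move=> u0 E i; elim/ltn_ind: i => i IH le_iN; have := E i le_iN.
rewrite !coefM !big_ord_recl u0 !mul1r subn0.
rewrite (eq_bigr (fun j : 'I_i => u`_(lift ord0 j) * q`_(i - lift ord0 j))).
  exact: addIr.
by move=> j _; rewrite lift0; congr (_ * _); apply: IH; move: (ltn_ord j); lia.
Qed.

Lemma qpoch_eq1 (R : comNzRingType) (N m n : nat) : (N <= m)%N ->
  eq_upto N (qpoch 'X m n) (1 : {poly R}).
Proof.
move=> le_Nm; rewrite /qpoch big_nat_cond.
elim/big_rec: _ => // i x /andP [/andP [le_mi _] _] E.
rewrite -[X in eq_upto _ _ X]mulr1; apply: eq_uptoM => // j le_jN.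
by rewrite coefB coefXn (_ : j == _ = false) ?subr0 //; lia.
Qed.

Lemma qpoch_stable (R : comNzRingType) (N m n : nat) :
  (N <= m)%N -> (N <= n)%N ->
  eq_upto N (qpoch 'X 0 m) (qpoch 'X 0 n : {poly R}).
Proof.
move=> le_Nm le_Nn.
suff S k : (N <= k)%N -> eq_upto N (qpoch 'X 0 k) (qpoch 'X 0 N : {poly R}).
  by apply: eq_upto_trans (S m le_Nm) _; apply/eq_upto_sym/S.
move=> le_Nk; rewrite -[X in eq_upto _ _ X]mulr1 /qpoch.
rewrite (big_cat_nat (leq0n N) le_Nk) //=.
by apply: eq_uptoM => //; apply: qpoch_eq1.
Qed.

Lemma qpoch_coef0 (R : comNzRingType) (m n : nat) :
  (qpoch 'X m n : {poly R})`_0 = 1.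
Proof.
rewrite /qpoch; elim/big_rec: _ => [|i x _ E]; first by rewrite coef1.
by rewrite coef0M E coefB coef1 coefXn subr0 mulr1.
Qed.

Lemma signr_polyC (R : nzRingType) (k : nat) :
  ((-1) ^+ k)%:P = (-1) ^+ k :> {poly R}.
Proof. by rewrite polyC_exp polyCN polyC1. Qed.

(** In Shanks's identity with n = N, the terms with s > 0 on the left have order above N, so up to
    degree N the right side is the Euler product. *)
Lemma euler_support (R : comNzRingType) (N i : nat) : (i <= N)%N ->
  (forall x, x * x != 24 * i + 1)%N -> (qpoch 'X 0 N : {poly R})`_i = 0.
Proof.
move=> le_iN nsq.
have tri j : ('C(j.+1, 2) * 2 = j * j.+1)%N.
  by elim: j => // j IHj; rewrite bin2S mulnDl IHj; lia.
have : (1 + \sum_(j < N) (-1) ^+ j.+1 *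
    ('X ^+ (j.+1 * j.+1 + 'C(j.+1, 2)) + 'X ^+ (j.+1 * j.+1 + 'C(j.+2, 2)))
    : {poly R})`_i = 0.
  rewrite coefD coef1 coef_sum big1 ?addr0 => [|j _].
    by case: i nsq {le_iN} => [/(_ 1%N)|].
  rewrite -signr_polyC coefCM coefD !coefXn.
  (* With J = j+1 the two exponents are J(3J-1)/2 and J(3J+1)/2, and 24 times them plus 1 gives the
     squares of 6J-1 and 6J+1. *)
  have -> : (i == j.+1 * j.+1 + 'C(j.+1, 2))%N = false.
    apply/eqP => Ei; have /eqP := nsq (6 * j + 5)%N; apply.
    by have := tri j; lia.
  have -> : (i == j.+1 * j.+1 + 'C(j.+2, 2))%N = false.
    apply/eqP => Ei; have /eqP := nsq (6 * j + 7)%N; apply.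
    by have := tri j.+1; lia.
  by rewrite addr0 mulr0.
move=> E; rewrite -[RHS]E -shanks big_ord_recl /= mul0n bin_small //.
rewrite expr0 !mul1r coefD coef_sum big1 ?addr0 // => s _.
by rewrite mulrAC coefMXn /bump leq0n add1n (_ : _ < _)%N // bin2S; lia.
Qed.

Lemma jacobi_coef (R : comNzRingType) (N i : nat) : (i <= N)%N ->
  ((qpoch 'X 0 N : {poly R}) ^+ 3)`_i =
  \sum_(k < N.+1 | 'C(k.+1, 2) == i) (-1) ^+ k * k.*2.+1%:R.
Proof.
have E : eq_upto N ((qpoch 'X 0 N : {poly R}) ^+ 3)
    (\sum_(k < N.+1) 'X^('C(k.+1, 2)) * ((-1) ^+ k * k.*2.+1%:R)).
  rewrite exprSr -finite_jacobi mulr_suml; apply: eq_upto_sum => k _.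
  have -> : k.*2.+1%:R * jcoef 'X N k * qpoch 'X 0 N =
    'X^('C(k.+1, 2)) * ((-1) ^+ k * k.*2.+1%:R *
      (qbin 'X (N.+1 - k) (N + k).+1 * qpoch 'X 0 N)) :> {poly R}.
    by rewrite /jcoef; ring.
  apply: eq_upto_Xn; rewrite -[X in eq_upto _ _ X]mulr1; apply: eq_uptoM => //.
  have le_kN : (k <= N)%N by rewrite -ltnS.
  (* Since 'C(k+1, 2) >= k, precision N - k suffices. Multiplying by one more [qpoch] then makes
     [qbin_qpoch] applicable, and all the products involved agree to that degree. *)
  apply: (@eq_upto_leq _ _ (N - k)).
    by rewrite bin2S; lia.
  apply: (@eq_upto_cancel _ _ (qpoch 'X 0 N)); first exact: qpoch_coef0.
  rewrite mulr1 subSn // mulrC.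
  apply: (@eq_upto_trans _ _ _ (qpoch 'X 0 ((N - k) + (N + k).+1))); last first.
    by apply: qpoch_stable; lia.
  rewrite -qbin_qpoch -!mulrA; apply: eq_uptoM => //.
  by apply: eq_uptoM; apply: qpoch_stable; lia.
move=> le_iN; rewrite E // coef_sum [RHS]big_mkcond /=; apply: eq_bigr => k _.
rewrite -signr_polyC -polyC_natr -polyCM coefMC coefXn eq_sym.
by case: eqP; rewrite ?mul1r ?mul0r.
Qed.

(** * The generating function of regular multipartitions *)

(* The partitions of i into parts at most m not divisible by l, for any fuel k
   at least m + i. *)
Fixpoint regparts (l k m i : nat) : seq (seq nat) :=
  match k, m with
  | k'.+1, m'.+1 =>
      regparts l k' m' i ++
      (if ~~ (l %| m)%N && (m <= i)%N
       then [seq m :: s | s <- regparts l k' m (i - m)] else [::])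
  | _, _ => if i == 0%N then [:: [::]] else [::]
  end.

Definition regpart_pred (l m i : nat) (s : seq nat) : bool :=
  [&& is_partition s, is_regular l s, all (leq^~ m) s & sumn s == i].

Lemma regpart_pred_cons (l m i x : nat) (s : seq nat) :
  regpart_pred l m i (x :: s) =
  [&& (0 < x)%N, (x <= m)%N, ~~ (l %| x)%N, (x <= i)%N
    & regpart_pred l x (i - x) s].
Proof.
rewrite /regpart_pred /is_partition /is_regular /= path_sortedE; last first.
  by move=> a b c /=; lia.
rewrite (_ : all (geq x) s = all (leq^~ x) s) //.
case: (boolP (all (leq^~ x) s)) => [alx | _]; last by rewrite !andbF /= ?andbF.
case: (boolP (x <= m)%N) => [le_xm | _]; last by rewrite /= !andbF.
have -> : all (leq^~ m) s.
  by apply: sub_all alx => y /= le_yx; apply: leq_trans le_xm.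
have -> : (x + sumn s == i)%N = (x <= i)%N && (sumn s == i - x)%N by lia.
by case: (sorted _ _); case: (0 < x)%N; case: (all _ s); case: (~~ _);
  case: (all _ s); case: (x <= i)%N.
Qed.

Lemma mem_regparts (l k m i : nat) (s : seq nat) : (m + i <= k)%N ->
  (s \in regparts l k m i) = regpart_pred l m i s.
Proof.
elim: k m i s => [|k IHk] [|m] i s le_k /=.
- have -> : i = 0%N by lia.
  rewrite inE; case: s => [|x s]; first by [].
  by rewrite regpart_pred_cons; case: x.
- by [].
- case: s => [|x s]; first by rewrite /regpart_pred /= eq_sym; case: eqP.
  by rewrite regpart_pred_cons; case: x => [|x] /=; case: eqP.
rewrite mem_cat IHk; last by lia.
case: s => [|x s].
  rewrite /regpart_pred /= orbC; case: ifP => // _.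
  by rewrite (negPf (_ : [::] \notin _)) //; apply/mapP => -[].
rewrite !regpart_pred_cons.
have E : (x :: s \in [seq m.+1 :: s0 | s0 <- regparts l k m.+1 (i - m.+1)]) =
    (x == m.+1) && (s \in regparts l k m.+1 (i - m.+1)).
  apply/mapP/andP => [[s' s'P [-> ->]] // | [/eqP -> sP]]; by exists s.
case: (eqVneq x m.+1) E => [-> | ne_xm] E.
  rewrite ltnn andbF /= leqnn /=.
  case: ifP => [/andP [-> le_mi]
    | /nandP [/negPf -> // | /negPf ->]]; last first.
    by rewrite in_nil andbF.
  by rewrite E IHk ?le_mi //; lia.
have -> : (x <= m.+1)%N = (x <= m)%N by lia.
case: ifP => _; last by rewrite in_nil orbF.
by rewrite E orbF.
Qed.

Lemma uniq_regparts (l k m i : nat) : (m + i <= k)%N -> uniq (regparts l k m i).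
Proof.
elim: k m i => [|k IHk] [|m] i le_k /=; try by case: eqP.
rewrite cat_uniq IHk; last by lia.
case: ifP => //= /andP [_ le_mi].
rewrite map_inj_uniq ?IHk ?andbT; [|by lia|by move=> s s' []].
apply/hasPn => _ /mapP [s _ ->].
by rewrite mem_regparts ?regpart_pred_cons ?ltnn ?andbF //; lia.
Qed.

Definition nregparts (l m i : nat) : nat := size (regparts l (m + i) m i).

Lemma size_regparts (l k m i : nat) : (m + i <= k)%N ->
  size (regparts l k m i) = nregparts l m i.
Proof.
move=> le_k; apply/perm_size/uniq_perm; rewrite ?uniq_regparts //.
by move=> s; rewrite !mem_regparts.
Qed.

Lemma nregparts0 (l i : nat) : nregparts l 0 i = (i == 0%N).
Proof. by case: i. Qed.

Lemma nregpartsS (l m i : nat) : nregparts l m.+1 i =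
  (nregparts l m i +
   if ~~ (l %| m.+1) && (m.+1 <= i) then nregparts l m.+1 (i - m.+1) else 0)%N.
Proof.
rewrite {1}/nregparts addSn /= size_cat; congr addn.
by case: ifP => // /andP [_ le_mi]; rewrite size_map size_regparts //; lia.
Qed.

Definition nregparts_poly (R : comNzRingType) (l N m : nat) : {poly R} :=
  \poly_(i < N.+1) (nregparts l m i)%:R.

(** By [nregpartsS], when l does not divide m+1, the factor 1 - X^(m+1) turns the series for parts
    at most m+1 into that for parts at most m; otherwise the two series coincide. *)
Lemma nregparts_poly_inv (R : comNzRingType) (l N m : nat) :
  eq_upto N (nregparts_poly R l N m *
             \prod_(j < m | ~~ (l %| j.+1)%N) (1 - 'X^(j.+1))) 1.
Proof.
elim: m => [|m IHm] i le_iN.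
  by rewrite big_ord0 mulr1 coef_poly ltnS le_iN nregparts0 coef1.
rewrite big_mkcond big_ord_recr -big_mkcond /=.
have [dv_lm | ndv_lm] := boolP (l %| m.+1)%N.
  have -> : nregparts_poly R l N m.+1 = nregparts_poly R l N m.
    by apply/polyP => j; rewrite !coef_poly nregpartsS dv_lm addn0.
  by rewrite mulr1 IHm.
rewrite mulrA mulrAC; apply: (eq_upto_trans _ IHm) => //.
apply: eq_uptoM => // {}i {}le_iN.
 rewrite mulrBr mulr1 coefB coefMXn !coef_poly ltnS le_iN.
rewrite nregpartsS ndv_lm /=; case: (leqP m.+1 i) => [le_mi | _].
  by rewrite (_ : i - m.+1 < N.+1)%N ?natrD ?addrK //; lia.
by rewrite addn0 subr0.
Qed.

Lemma card_regular_parts (l n i : nat) : (i <= n)%N ->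
  #|[set s : {bseq n of 'I_n.+1} |
      is_partition (parts s) && is_regular l (parts s) & sumn (parts s) == i]| =
  nregparts l n i.
Proof.
move=> le_in; rewrite cardE -(size_map (@parts n)).
apply/perm_size/uniq_perm; rewrite ?uniq_regparts //.
  rewrite map_inj_uniq ?enum_uniq // => s s' E; apply/val_inj.
  exact: inj_map val_inj _ _ E.
move=> s; rewrite mem_regparts //; apply/mapP/idP => [[s' + ->] | ].
  rewrite mem_enum inE => /andP [/andP [s'P s'R] s'S].
  rewrite /regpart_pred s'P s'R s'S andbT /=.
  by apply/allP => _ /mapP [x _ ->]; exact: (ltn_ord x).
case/and4P => sP sR sM sS.
(* Parts are positive, so there are at most i <= n of them and the partition fits into the bounded
   type. *)
have sz : (size s <= n)%N.
  apply: leq_trans le_in; rewrite -(eqP sS).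
  have /andP [_] := sP; elim: {sP sR sM sS} s => //= x s IHs /andP [x0 /IHs].
  by lia.
have sz' : (size [seq inord x : 'I_n.+1 | x <- s] <= n)%N by rewrite size_map.
have Es : s = parts (Bseq sz').
  rewrite /parts /= -map_comp -[LHS]map_id; apply/eq_in_map => x xs /=.
  by rewrite inordK // ltnS; exact: (allP sM).
by exists (Bseq sz') => //; rewrite mem_enum inE -Es sP sR sS.
Qed.

Lemma sum_tuple_expr (R : comNzRingType) (T : finType) (P : pred T)
    (F : T -> R) (r : nat) :
  (\sum_(x | P x) F x) ^+ r =
  \sum_(t : r.-tuple T | all P t) \prod_(x <- t) F x.
Proof.
transitivity (\prod_(i < r) \sum_(x | P x) F x).
  by rewrite prodr_const card_ord.
rewrite bigA_distr_big /=.
rewrite (reindex (fun t : r.-tuple T => [ffun i => tnth t i])) /=; last first.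
  exists (fun f : {ffun 'I_r -> T} => [tuple f i | i < r]) => [t _ | f _].
    by apply: eq_from_tnth => i; rewrite tnth_mktuple ffunE.
  by apply/ffunP => i; rewrite ffunE tnth_mktuple.
apply: eq_big => [t | t _].
  apply/ffun_onP/all_tnthP => H i; by have := H i; rewrite ffunE.
by rewrite big_tuple; apply: eq_bigr => i _; rewrite ffunE.
Qed.

(** Expanding the r-th power of the sum of X^|s| over components s gives one monomial per tuple. The
    finite type also contains components of size above n, hence the comparison only up to degree
    n. *)
Lemma B_coef (R : comNzRingType) (l r n : nat) :
  (B l r n)%:R = (nregparts_poly R l n n ^+ r)`_n.
Proof.
pose P (s : {bseq n of 'I_n.+1}) :=
  is_partition (parts s) && is_regular l (parts s).
have E : eq_upto n (\sum_(s | P s) 'X^(sumn (parts s)))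
    (nregparts_poly R l n n).
  move=> i le_in; rewrite coef_poly ltnS le_in -card_regular_parts // coef_sum.
  rewrite -sum1_card natr_sum big_mkcond [RHS]big_mkcond /=.
  apply: eq_bigr => s _.
  rewrite inE -/(P s) coefXn (eq_sym i).
  by case: (P s); case: eqP.
rewrite -(eq_uptoX r E) // sum_tuple_expr coef_sum /B -sum1_card natr_sum.
rewrite big_mkcond [RHS]big_mkcond /=; apply: eq_bigr => t _.
rewrite inE; case: (all P t) => //=.
rewrite -[in RHS](big_morph _ (@exprD _ 'X) (expr0 'X)).
by rewrite coefXn eq_sym; case: eqP.
Qed.

(** * Congruences *)

(** These are the polynomials in X^d. *)
Definition sparse (R : nzRingType) (d : nat) (f : {poly R}) : Prop :=
  forall i, ~~ (d %| i)%N -> f`_i = 0.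

Lemma sparse1 (R : nzRingType) (d : nat) : sparse d (1 : {poly R}).
Proof. by move=> [|i] nd; rewrite ?dvdn0 ?coef1 in nd *. Qed.

Lemma sparseM (R : nzRingType) (d : nat) (f g : {poly R}) :
  sparse d f -> sparse d g -> sparse d (f * g).
Proof.
move=> sf sg i ndi; rewrite coefM big1 // => j _.
have [dj | /sf ->] := boolP (d %| j)%N; last by rewrite mul0r.
rewrite [g`__]sg ?mulr0 //; apply: contra ndi => dij.
by rewrite -(subnK (_ : j <= i)%N) ?dvdn_add // -ltnS.
Qed.

Lemma sparseX (R : nzRingType) (d k : nat) (f : {poly R}) :
  sparse d f -> sparse d (f ^+ k).
Proof.
move=> sf; elim: k => [|k IHk]; first exact: sparse1.
by rewrite exprS; exact: sparseM.
Qed.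

Lemma sparse_1subXn (R : nzRingType) (d k : nat) :
  (d %| k)%N -> sparse d (1 - 'X^k : {poly R}).
Proof.
move=> dk i ndi; rewrite coefB coefXn coef1; case: eqP ndi => [-> | _ ndi].
  by rewrite dvdn0.
by case: eqP ndi => [-> | _]; rewrite ?dk ?subr0.
Qed.

(** By Frobenius, (1 - X^i)^p = 1 - X^(ip) in characteristic p. *)
Lemma sparse_qpoch_expr (R : comNzRingType) (p m n : nat) :
  p \in [pchar R] -> sparse p ((qpoch 'X m n : {poly R}) ^+ p).
Proof.
move=> pR; have pRX : p \in [pchar {poly R}] by rewrite pchar_poly.
rewrite /qpoch -prodrXl.
elim/big_rec: _ => [|i f _ sf]; first exact: sparse1.
apply: sparseM => //; rewrite -(pFrobenius_autE pRX) rmorphB rmorph1.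
by rewrite /= pFrobenius_autE -exprM; apply/sparse_1subXn/dvdn_mull.
Qed.

Lemma sparse_mul_vanish (R : nzRingType) (d N a : nat) (f g : {poly R}) :
  sparse d f -> (forall i, (i <= N)%N -> i = a %[mod d] -> g`_i = 0) ->
  forall i, (i <= N)%N -> i = a %[mod d] -> (f * g)`_i = 0.
Proof.
move=> sf g0 i le_iN ia; rewrite coefM big1 // => j _.
have [dj | /sf ->] := boolP (d %| j)%N; last by rewrite mul0r.
have le_ji : (j <= i)%N by rewrite -ltnS.
rewrite g0 ?mulr0 //; first by apply: leq_trans le_iN; apply: leq_subr.
by rewrite -ia -[in RHS](subnK le_ji) -modnDmr (eqP dj) addn0.
Qed.

(** Strong induction on i: the terms of the convolution with j > 0 involve either a zero coefficient
    of [f] or an earlier coefficient of [g] in the same class. *)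
Lemma sparse_div_vanish (R : nzRingType) (d N a : nat) (f g : {poly R}) :
  f`_0 = 1 -> sparse d f ->
  (forall i, (i <= N)%N -> i = a %[mod d] -> (f * g)`_i = 0) ->
  forall i, (i <= N)%N -> i = a %[mod d] -> g`_i = 0.
Proof.
move=> f0 sf fg0 i; elim/ltn_ind: i => i IH le_iN ia.
move: (fg0 i le_iN ia); rewrite coefM big_ord_recl f0 mul1r subn0.
rewrite big1 ?addr0 //.
move=> j _; rewrite lift0.
have [dj | /sf ->] := boolP (d %| j.+1)%N; last by rewrite mul0r.
have lt_ji := ltn_ord j; rewrite IH ?mulr0 //; [by lia | by lia |].
by rewrite -ia -[in RHS](subnK lt_ji) -modnDmr (eqP dj) addn0.
Qed.

Lemma qpoch_ordE (R : comNzRingType) (N : nat) :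
  qpoch 'X 0 N = \prod_(j < N) (1 - 'X^(j.+1)) :> {poly R}.
Proof. by rewrite /qpoch big_mkord. Qed.

Lemma dvdn_B (p l r e N : nat) :
  prime p -> (p %| l)%N -> (p %| r + e)%N ->
  (forall i, (i <= N)%N -> i = N %[mod p] ->
     ((qpoch 'X 0 N : {poly 'F_p}) ^+ e)`_i = 0) ->
  (p %| B l r N)%N.
Proof.
move=> p_pr pl pre vE.
have pF := pchar_Fp p_pr; rewrite (dvdn_pcharf pF) B_coef; apply/eqP.
set G := nregparts_poly _ _ _ _; set E := qpoch _ _ _ in vE *.
(* [D] is E_l truncated; it is a polynomial in X^p because p divides l. *)
pose D := \prod_(j < N | (l %| j.+1)%N) (1 - 'X^(j.+1)) : {poly 'F_p}.
have GE : eq_upto N (G * E) D.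
  rewrite /E qpoch_ordE (bigID (fun j : 'I_N => (l %| j.+1)%N)) /= mulrCA.
  by rewrite -[X in eq_upto _ _ X]mulr1; apply/eq_uptoM/nregparts_poly_inv.
have sD : sparse p D.
  rewrite /D; elim/big_rec: _ => [|j f lj sf]; first exact: sparse1.
  by apply: sparseM => //; apply: sparse_1subXn; apply: dvdn_trans lj.
have [k Dk] := dvdnP pre.
apply: (@sparse_div_vanish _ p N N ((E ^+ p) ^+ k)) => //.
- by rewrite -exprM -horner_coef0 horner_exp horner_coef0 qpoch_coef0 expr1n.
- exact/sparseX/sparse_qpoch_expr.
move=> i le_iN iN.
have -> : (E ^+ p) ^+ k * G ^+ r = (G * E) ^+ r * E ^+ e.
  by rewrite -exprM mulnC -Dk exprD exprMn; ring.
rewrite (eq_uptoM (eq_uptoX r GE) (_ : eq_upto N _ (E ^+ e))) //.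
by apply: sparse_mul_vanish le_iN iN => //; exact: sparseX.
Qed.

(** A finite test that 24 c + 1 is not a square modulo p, so that the class c contains no
    generalized pentagonal number. *)
Definition euler_gap (p c : nat) : bool :=
  all (fun y => y * y != 24 * c + 1 %[mod p])%N (iota 0 p).

(** A triangular number k(k+1)/2 in the class c satisfies (2k+1)^2 = 8 c + 1 modulo p; the test
    forces p to divide 2k+1, Jacobi's coefficient up to sign. *)
Definition jacobi_gap (p c : nat) : bool :=
  all (fun y => (y * y == 8 * c + 1 %[mod p]) ==> (y == 0))%N (iota 0 p).

Lemma euler_residue (R : comNzRingType) (p N i : nat) :
  (0 < p)%N -> euler_gap p (i %% p) -> (i <= N)%N ->
  (qpoch 'X 0 N : {poly R})`_i = 0.
Proof.
move=> p0 /allP gap le_iN; apply: euler_support => // x.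
have /gap : (x %% p)%N \in iota 0 p by rewrite mem_iota ltn_mod.
by apply: contra => /eqP Ex; rewrite modnMm Ex -modnDml -modnMmr modnDml.
Qed.

Lemma jacobi_residue (R : comNzRingType) (p N i : nat) :
  p \in [pchar R] -> jacobi_gap p (i %% p) -> (i <= N)%N ->
  ((qpoch 'X 0 N : {poly R}) ^+ 3)`_i = 0.
Proof.
move=> pR /allP gap le_iN; rewrite jacobi_coef // big1 // => k /eqP ki.
have p0 : (0 < p)%N by apply/prime_gt0/(pcharf_prime pR).
suff : (p %| k.*2.+1)%N by rewrite (dvdn_pcharf pR) => /eqP ->; rewrite mulr0.
have /gap : (k.*2.+1 %% p)%N \in iota 0 p by rewrite mem_iota ltn_mod.
move=> /implyP; apply; rewrite modnMm -[in eqbRHS]modnDml modnMmr modnDml.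
rewrite (_ : k.*2.+1 * k.*2.+1 = 8 * i + 1)%N // -ki -muln2.
by have := mul_bin_diag k.+1 1; rewrite bin1 /=; lia.
Qed.

Lemma dvdn_B_euler (p l r N : nat) :
  prime p -> (p %| l)%N -> (p %| r + 1)%N -> euler_gap p (N %% p) ->
  (p %| B l r N)%N.
Proof.
move=> p_pr pl pr gap; apply: (dvdn_B p_pr pl pr) => i le_iN iN.
by rewrite expr1 (@euler_residue 'F_p p) ?iN ?prime_gt0.
Qed.

Lemma dvdn_B_jacobi (p l r N : nat) :
  prime p -> (p %| l)%N -> (p %| r + 3)%N -> jacobi_gap p (N %% p) ->
  (p %| B l r N)%N.
Proof.
move=> p_pr pl pr gap; apply: (dvdn_B p_pr pl pr) => i le_iN iN.
by rewrite (@jacobi_residue 'F_p p) ?iN ?pchar_Fp.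
Qed.

(* Modulo 5 the exponents in E_1 are 0, 1, 2 and those in E_1^3 are 0, 1, so that
   no exponent of E_1^4 = E_1 E_1^3 is 4. *)
Lemma dvdn5_B (l r N : nat) :
  (5 %| l)%N -> (5 %| r + 4)%N -> (N %% 5 = 4)%N -> (5 %| B l r N)%N.
Proof.
move=> l5 r5 N4; apply: (@dvdn_B 5 l r 4) => // i le_iN; rewrite N4 => i4.
rewrite exprS coefM big1 // => j _; have le_ji : (j <= i)%N by rewrite -ltnS.
have [gap | ngap] := boolP (euler_gap 5 (j %% 5)).
  by rewrite (@euler_residue 'F_5 5) ?mul0r //; apply: leq_trans le_iN.
rewrite (@jacobi_residue 'F_5 5) ?mulr0 ?pchar_Fp //; last by lia.
have : (j %% 5 < 5)%N by rewrite ltn_mod.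
(* The added 5 keeps the natural subtraction from truncating. For j = 0, 1, 2 modulo 5 the class of
   i - j is 4, 3, 2, always a gap for the cube. *)
have -> : ((i - j) %% 5 = (4 + 5 - j %% 5) %% 5)%N by lia.
by move: ngap; case: (j %% 5)%N => [|[|[|[|[|]]]]].
Qed.

Lemma eq0_mod35 (b : nat) : (5 %| b)%N -> (7 %| b)%N -> (b = 0 %[mod 35])%N.
Proof.
by move=> b5 b7; apply/eqP; rewrite mod0n -/(35 %| b)%N (@Gauss_dvd 5 7) ?b5.
Qed.

Lemma mod_35MDl (p n a : nat) : (p %| 35)%N -> (35 * n + a = a %[mod p])%N.
Proof. by move=> p35; rewrite -modnDml (eqP (dvdn_mulr n p35)). Qed.

Local Close Scope ring_scope.

Theorem theorem1p6 (n t : nat) :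
  (forall a : nat, a \in [:: 13; 34] ->
     B 35 (35 * t + 4) (35 * n + a) = 0 %[mod 35]) /\
  (forall a : nat, a \in [:: 4; 24; 34] ->
     B 35 (35 * t + 6) (35 * n + a) = 0 %[mod 35]) /\
  (B 35 (35 * t + 11) (35 * n + 34) = 0 %[mod 35]) /\
  (forall a : nat, a \in [:: 3; 4; 13; 17; 18; 24; 27; 32; 34] ->
     B 35 (35 * t + 27) (35 * n + a) = 0 %[mod 35]) /\
  (forall a : nat, a \in [:: 13; 27; 34] ->
     B 35 (35 * t + 32) (35 * n + a) = 0 %[mod 35]) /\
  (forall a : nat, a \in [:: 3; 4; 13; 18; 24; 34] ->
     B 35 (35 * t + 34) (35 * n + a) = 0 %[mod 35]).
Proof.
have r5 c e : 5 %| c + e -> 5 %| 35 * t + c + e.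
  by rewrite -addnA => ?; rewrite dvdn_add // dvdn_mulr.
have r7 c e : 7 %| c + e -> 7 %| 35 * t + c + e.
  by rewrite -addnA => ?; rewrite dvdn_add // dvdn_mulr.
repeat split; (try move=> a ha); apply: eq0_mod35.
(* Each item yields a goal modulo 5, then one modulo 7. For r = 35t + c, the exponent e is 1 if c =
   -1, 3 if c = -3, and 4 if c = 1 modulo 5. The residues a are checked by computation. *)
- by apply: dvdn_B_euler; rewrite ?r5 ?mod_35MDl //; move: a ha; apply/allP.
- by apply: dvdn_B_jacobi; rewrite ?r7 ?mod_35MDl //; move: a ha; apply/allP.
- apply: dvdn5_B; rewrite ?r5 ?mod_35MDl //.
  by apply/eqP; move: a ha; apply/allP.
- by apply: dvdn_B_euler; rewrite ?r7 ?mod_35MDl //; move: a ha; apply/allP.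
- by apply: dvdn5_B; rewrite ?r5 ?mod_35MDl.
- by apply: dvdn_B_jacobi; rewrite ?r7 ?mod_35MDl.
- by apply: dvdn_B_jacobi; rewrite ?r5 ?mod_35MDl //; move: a ha; apply/allP.
- by apply: dvdn_B_euler; rewrite ?r7 ?mod_35MDl //; move: a ha; apply/allP.
- by apply: dvdn_B_jacobi; rewrite ?r5 ?mod_35MDl //; move: a ha; apply/allP.
- by apply: dvdn_B_jacobi; rewrite ?r7 ?mod_35MDl //; move: a ha; apply/allP.
- by apply: dvdn_B_euler; rewrite ?r5 ?mod_35MDl //; move: a ha; apply/allP.
- by apply: dvdn_B_euler; rewrite ?r7 ?mod_35MDl //; move: a ha; apply/allP.
Qed.
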